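(* Let $R$ be a prime ring and let $I$ be a nonzero left ideal of $R$. Let $F$ and $H$ be generalized derivations of $R$ associated to derivations $f$ and $h$ of $R$, respectively, such that $F(x)F(y)-H(yx)\in Z(R)$ for all $x,y\in I$. If $0\neq If(I)\subseteq I$ and $0\neq Ih(I)\subseteq I$, then $R$ is commutative.
   Context: Rings are associative (not assumed unital or commutative); $Z(R)$ is the center of $R$. $R$ is prime if for $a,b\in R$, $aRb=\{0\}$ implies $a=0$ or $b=0$. A derivation of $R$ is an additive map $d:R\to R$ with $d(xy)=d(x)y+xd(y)$ for all $x,y\in R$. A generalized derivation of $R$ associated to a derivation $d$ of $R$ is an additive map $F:R\to R$ with $F(xy)=F(x)y+xd(y)$ for all $x,y\in R$. For a derivation $d$, $0\neq Id(I)\subseteq I$ means that $u\,d(v)\in I$ for all $u,v\in I$ and that $u\,d(v)\neq 0$ for some $u,v\in I$. *)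

(* Defs.v *)
From HB Require Import structures.
From mathcomp Require Import all_boot all_order all_algebra.
From mathcomp Require Import classical_sets.

Set Implicit Arguments.
Unset Strict Implicit.
Unset Printing Implicit Defensive.

Import GRing.Theory.
Local Open Scope ring_scope.

(* Every ring structure of ssralg has a unit; rngType is an associative ring
   that need be neither unital nor commutative, and may be zero. *)
HB.mixin Record Zmodule_isRng R of GRing.Zmodule R := {
  rmul : R -> R -> R;
  rmulA : associative rmul;
  rmulDl : left_distributive rmul +%R;
  rmulDr : right_distributive rmul +%R
}.

#[short(type="rngType")]
HB.structure Definition Rng := { R of GRing.Zmodule R & Zmodule_isRng R }.

(* A symbol of its own, so that _ * _ remains the product of unital rings. *)
Notation "x ** y" := (rmul x y) (at level 40, left associativity) : ring_scope.

Section Rng.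
Variable R : rngType.

Definition center : set R := [set z | forall x : R, z ** x = x ** z].

Definition prime_rng : Prop :=
  forall a b : R, (forall r : R, a ** r ** b = 0) -> a = 0 \/ b = 0.

Definition left_ideal (I : set R) : Prop :=
  [/\ I 0,
      forall x y, I x -> I y -> I (x - y)
    & forall r x, I x -> I (r ** x)].

Definition derivation (d : {additive R -> R}) : Prop :=
  forall x y, d (x ** y) = d x ** y + x ** d y.

Definition generalized_derivation (F d : {additive R -> R}) : Prop :=
  derivation d /\ forall x y, F (x ** y) = F x ** y + x ** d y.

(* 0 <> I d(I) `<=` I, elementwise *)
Definition nonzero_stable (d : R -> R) (I : set R) : Prop :=
  (forall u v, I u -> I v -> I (u ** d v)) /\
  (exists u v, [/\ I u, I v & u ** d v <> 0]).

End Rng.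

Arguments center : clear implicits.

(* Main.v *)
Require Import Defs.
From mathcomp Require Import all_boot all_order all_algebra.
From mathcomp Require Import boolp classical_sets.

(* Write P x y = F x ** F y - H (y ** x), and suppose R is not commutative.

   Comparing P x (y ** x) with P x y ** x gives
     F x ** y ** f x - y ** x ** h x = P x (y ** x) - P x y ** x.   (1)

   If I meets the center Z in 0 only, then P x (u ** v), which lies both in I
   and in Z, vanishes on I, so F x ** y ** f x = y ** x ** h x for y in I ** I.
   Replacing y by r ** y shows that F x commutes with R or I ** f x = 0. By
   additivity one alternative holds on all of I, hence F I lies in Z; then F
   kills I ** I, so H kills I ** I ** I, and finally I ** h I = 0, a
   contradiction.

   Otherwise pick c <> 0 in I and Z. Comparing P x (y ** c) with P x y ** c
   forces f c = h c = 0, and since c ** R lies in I, P has values in Z on all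
   of R. After division by c, that is, as if c were 1, a = F 1 and H 1 satisfy
   F x = a x + f x and h x = a f x + k x - p x with k, p x in Z; that h is a
   derivation forces a in Z, k = 0 and p = 0, and (1) becomes
     [F x, y] f x + y (f x)^2 = P x (y x) - P x y x,
   with (f x)^2 = P x x in Z. The right-hand side commutes with x; putting
   F x ** y for y yields [f x, x] = 0 or (f x)^2 = 0, and the second case also
   gives [f x, x] = 0. Posner's theorem then makes R commutative. *)

Set Implicit Arguments.
Unset Strict Implicit.
Unset Printing Implicit Defensive.

Import GRing.Theory.
Local Open Scope ring_scope.

(** * Zero and signs in a ring without unit *)

Section RngTheory.
Variable R : rngType.
Implicit Types x y z : R.

Lemma rmul0l x : 0 ** x = 0.
Proof. by apply: (addrI (0 ** x)); rewrite -rmulDl !addr0. Qed.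

Lemma rmul0r x : x ** 0 = 0.
Proof. by apply: (addrI (x ** 0)); rewrite -rmulDr !addr0. Qed.

Lemma rmulNl x y : - x ** y = - (x ** y).
Proof. by apply: (addrI (x ** y)); rewrite -rmulDl !subrr rmul0l. Qed.

Lemma rmulNr x y : x ** - y = - (x ** y).
Proof. by apply: (addrI (x ** y)); rewrite -rmulDr !subrr rmul0r. Qed.

End RngTheory.

(** * Rng identities by reflection *)

Inductive rng_expr :=
  | RVar of bool * nat | RZero | RAdd of rng_expr & rng_expr
  | ROpp of rng_expr | RMul of rng_expr & rng_expr.

Section RngNormalization.
Variables (R : rngType) (zs xs : seq R).

Definition rng_atom (a : bool * nat) : R :=
  if a.1 then nth 0 zs a.2 else nth 0 xs a.2.

(* As R has no unit, the empty word has the junk value 0, and a product with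
   an empty word is dropped in [rng_norm]. *)
Fixpoint rng_word (w : seq (bool * nat)) : R :=
  if w is a :: w' then
    if w' is [::] then rng_atom a else rng_atom a ** rng_word w'
  else 0.

Fixpoint rng_eval e : R :=
  match e with
  | RVar a => rng_atom a
  | RZero => 0
  | RAdd e1 e2 => rng_eval e1 + rng_eval e2
  | ROpp e1 => - rng_eval e1
  | RMul e1 e2 => rng_eval e1 ** rng_eval e2
  end.

(** Atoms flagged [true] stand for central elements: they are sorted to the front, and the others
    keep their mutual order. *)
Fixpoint rng_insert (a : bool * nat) (w : seq (bool * nat)) :=
  if w is b :: w' then
    if ~~ b.1 || a.1 && (a.2 <= b.2)%N then a :: w else b :: rng_insert a w'
  else [:: a].

Definition rng_sort := foldr rng_insert [::].

Definition rng_mulm (m1 m2 : bool * seq (bool * nat)) :=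
  if nilp m1.2 || nilp m2.2 then [::]
  else [:: (m1.1 (+) m2.1, m1.2 ++ m2.2)].

Fixpoint rng_norm e : seq (bool * seq (bool * nat)) :=
  match e with
  | RVar a => [:: (false, [:: a])]
  | RZero => [::]
  | RAdd e1 e2 => rng_norm e1 ++ rng_norm e2
  | ROpp e1 => [seq (~~ m.1, m.2) | m <- rng_norm e1]
  | RMul e1 e2 =>
      flatten [seq rng_mulm m1 m2 | m1 <- rng_norm e1, m2 <- rng_norm e2]
  end.

Definition rng_words s e :=
  [seq rng_sort m.2 | m <- rng_norm e & m.1 == s].

(** The flag [true] of a monomial is a minus sign; no coefficients are collected, only multisets of
    words are compared. *)
Definition rng_null e := perm_eq (rng_words true e) (rng_words false e).

Definition rng_mono (m : bool * seq (bool * nat)) : R :=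
  if m.1 then - rng_word m.2 else rng_word m.2.

Lemma rng_word_cons a w :
  w != [::] -> rng_word (a :: w) = rng_atom a ** rng_word w.
Proof. by case: w. Qed.

Lemma rng_word_cat w1 w2 : w1 != [::] -> w2 != [::] ->
  rng_word (w1 ++ w2) = rng_word w1 ** rng_word w2.
Proof.
elim: w1 => // a [|b w1] IH _ w2_neq0; first exact: rng_word_cons.
by rewrite cat_cons rng_word_cons // IH // [in RHS]rng_word_cons // rmulA.
Qed.

Lemma rng_mulmE m1 m2 :
  \sum_(m <- rng_mulm m1 m2) rng_mono m = rng_mono m1 ** rng_mono m2.
Proof.
case: m1 m2 => [s1 [|a1 w1]] [s2 [|a2 w2]]; rewrite /rng_mulm /=.
- by rewrite big_nil /rng_mono /=; case: ifP; rewrite ?oppr0 rmul0l.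
- by rewrite big_nil /rng_mono /=; case: ifP; rewrite ?oppr0 rmul0l.
- by rewrite big_nil /rng_mono /=; case: s2; rewrite ?oppr0 rmul0r.
rewrite big_seq1 /rng_mono -cat_cons rng_word_cat //.
by case: s1; case: s2; rewrite /= ?rmulNl ?rmulNr ?opprK.
Qed.

Lemma rng_normE e : rng_eval e = \sum_(m <- rng_norm e) rng_mono m.
Proof.
elim: e => [a||e1 IH1 e2 IH2|e1 IH1|e1 IH1 e2 IH2] /=.
- by rewrite big_seq1.
- by rewrite big_nil.
- by rewrite big_cat IH1 IH2.
- rewrite big_map IH1 -sumrN; apply: eq_bigr => -[[] w] _ //=.
  by rewrite /rng_mono opprK.
rewrite big_flatten big_allpairs_dep IH1 IH2 /=.
elim: (rng_norm e1) => [|m1 l1 IH]; first by rewrite !big_nil rmul0l.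
rewrite !big_cons rmulDl -IH; congr (_ + _).
elim: (rng_norm e2) => [|m2 l2 IH2']; first by rewrite !big_nil rmul0r.
by rewrite !big_cons rmulDr -IH2' rng_mulmE.
Qed.

Hypothesis zs_center : forall n, center R (nth 0 zs n).

Lemma rng_sortE w : rng_word (rng_sort w) = rng_word w.
Proof.
have insE a u : rng_word (rng_insert a u) = rng_word (a :: u).
  elim: u => // b u IH; rewrite [rng_insert _ _]/=; case: ifP => // ab.
  have bZ : center R (rng_atom b).
    by move: ab; rewrite /rng_atom; case: (b.1) => // _; apply: zs_center.
  have ins_neq0 : rng_insert a u != [::] by case: u {IH} => //= ? ?; case: ifP.
  rewrite rng_word_cons // IH; case: u {IH ins_neq0} => [|d u].
    by rewrite /= bZ.
  rewrite (@rng_word_cons a (d :: u)) // (@rng_word_cons a (b :: d :: u)) //.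
  by rewrite (@rng_word_cons b (d :: u)) // !rmulA bZ.
elim: w => // a w IH; rewrite [rng_sort _]/= insE.
case: w IH => // b w IH; rewrite rng_word_cons ?IH ?[RHS]rng_word_cons //.
have: forall c u, rng_insert c u != [::] by move=> c [|d u] //=; case: ifP.
by apply.
Qed.

Lemma rng_nullP e : rng_null e -> rng_eval e = 0.
Proof.
move=> e0; rewrite rng_normE (bigID (fun m => m.1 == true)) /=.
have sumE s : \sum_(m <- rng_norm e | m.1 == s) rng_word m.2 =
              \sum_(w <- rng_words s e) rng_word w.
  by rewrite big_map big_filter; apply: eq_bigr => m _; rewrite rng_sortE.
rewrite (eq_bigr (fun m => - rng_word m.2)); last by move=> [[] w].
rewrite sumrN sumE (eq_bigl (fun m => m.1 == false)); last by move=> [[] w].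
rewrite [X in _ + X](eq_bigr (fun m => rng_word m.2)); last by move=> [[] w].
by rewrite sumE (perm_big _ e0) addNr.
Qed.

Lemma rng_eqP e1 e2 : rng_null (RAdd e1 (ROpp e2)) ->
  rng_eval e1 = rng_eval e2.
Proof. by move/rng_nullP/subr0_eq. Qed.

End RngNormalization.

Lemma nth_center_nil (R : rngType) n : center R (nth 0 [::] n).
Proof. by move=> x; rewrite nth_nil rmul0l rmul0r. Qed.

Lemma nth_center_cons (R : rngType) (z : R) zs : center R z ->
  (forall n, center R (nth 0 zs n)) -> forall n, center R (nth 0 (z :: zs) n).
Proof. by move=> zZ zsZ [|n]; [apply: zZ | apply: zsZ]. Qed.

Ltac rng_index x l :=
  lazymatch l with
  | x :: _ => constr:(0%N)
  | _ :: ?l' => let n := rng_index x l' in constr:(S n)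
  end.

Ltac rng_insert_atom x l :=
  match l with
  | _ => let _ := rng_index x l in l
  | _ => constr:(x :: l)
  end.

Ltac rng_atoms e env :=
  lazymatch e with
  | GRing.add ?a ?b => let env := rng_atoms a env in rng_atoms b env
  | GRing.opp ?a => rng_atoms a env
  | rmul ?a ?b => let env := rng_atoms a env in rng_atoms b env
  | GRing.zero => env
  | ?a => lazymatch env with
      (?zs, ?xs) =>
        match goal with
        | _ : center _ a |- _ =>
            let zs := rng_insert_atom a zs in constr:((zs, xs))
        | _ => let xs := rng_insert_atom a xs in constr:((zs, xs))
        end
      end
  end.

Ltac rng_reify e zs xs :=
  lazymatch e with
  | GRing.add ?a ?b =>
      let a := rng_reify a zs xs in let b := rng_reify b zs xs in
      constr:(RAdd a b)
  | GRing.opp ?a => let a := rng_reify a zs xs in constr:(ROpp a)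
  | rmul ?a ?b =>
      let a := rng_reify a zs xs in let b := rng_reify b zs xs in
      constr:(RMul a b)
  | GRing.zero => constr:(RZero)
  | ?a =>
      match goal with
      | _ => let n := rng_index a zs in constr:(RVar (true, n))
      | _ => let n := rng_index a xs in constr:(RVar (false, n))
      end
  end.

(* Proves identities of rngs, moving to the front every factor [z] for which
   [center _ z] is an assumption. *)
Ltac rng :=
  cbv beta;
  intros;
  lazymatch goal with
  | |- @eq ?T ?l ?r =>
      let env := rng_atoms l (@nil T, @nil T) in
      let env := rng_atoms r env in
      lazymatch env with
      | (?zs, ?xs) =>
          let el := rng_reify l zs xs in
          let er := rng_reify r zs xs in
          refine (@rng_eqP _ zs xs _ el er _);
          [ repeat (first [exact: nth_center_nil
                          | apply: nth_center_cons; first by assumption])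
          | vm_compute; reflexivity ]
      end
  end.

(** Serves [rng from e], where [e] is a combination of known equations built by [eqD], [eqN], [eqB],
    [eqMl] and [eqMr]. *)
Lemma eq_from_sub (V : zmodType) (a b l r : V) :
  a = b -> l - r = a - b -> l = r.
Proof. by move=> ->; rewrite subrr => /subr0_eq. Qed.

Tactic Notation "rng" "from" constr(e) := apply: (eq_from_sub e); rng.

Lemma eqD (V : zmodType) (a b a' b' : V) :
  a = b -> a' = b' -> a + a' = b + b'.
Proof. by move=> -> ->. Qed.

Lemma eqN (V : zmodType) (a b : V) : a = b -> - a = - b.
Proof. by move=> ->. Qed.

Lemma eqB (V : zmodType) (a b a' b' : V) :
  a = b -> a' = b' -> a - a' = b - b'.
Proof. by move=> -> ->. Qed.

Lemma eqMl (R : rngType) (x a b : R) : a = b -> x ** a = x ** b.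
Proof. by move=> ->. Qed.

Lemma eqMr (R : rngType) (x a b : R) : a = b -> a ** x = b ** x.
Proof. by move=> ->. Qed.

(** * Cancellation and commutation in prime rings *)

Section PrimeRing.
Variables (R : rngType) (primeR : prime_rng R).
Implicit Types (a b r s u v w x y z : R) (I : set R).

Lemma centerD z u : center R z -> center R u -> center R (z + u).
Proof. by move=> zZ uZ x; rng. Qed.

Lemma centerN z : center R z -> center R (- z).
Proof. by move=> zZ x; rng. Qed.

Lemma centerB z u : center R z -> center R u -> center R (z - u).
Proof. by move=> zZ uZ; apply/centerD/centerN. Qed.

Lemma centerM z u : center R z -> center R u -> center R (z ** u).
Proof. by move=> zZ uZ x; rng. Qed.

Lemma center_derivation (d : {additive R -> R}) z :
  derivation d -> center R z -> center R (d z).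
Proof.
move=> dM zZ x; have e := congr1 d (zZ x); rewrite !dM in e.
by rng from e.
Qed.

Lemma prime_mulIl a b : b <> 0 -> (forall r, a ** r ** b = 0) -> a = 0.
Proof. by move=> b_neq0 /primeR[]. Qed.

Lemma prime_mulIr a b : a <> 0 -> (forall r, a ** r ** b = 0) -> b = 0.
Proof. by move=> a_neq0 /primeR[]. Qed.

Lemma center_mulI z u : center R z -> z <> 0 -> z ** u = 0 -> u = 0.
Proof.
move=> zZ z_neq0 zu0; apply: (prime_mulIr z_neq0) => r.
by rewrite zZ -rmulA zu0 rmul0r.
Qed.

Lemma center_mul_center z u :
  center R z -> z <> 0 -> center R (z ** u) -> center R u.
Proof.
move=> zZ z_neq0 zuZ x; apply/subr0_eq/(center_mulI zZ z_neq0).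
by rng from (zuZ x).
Qed.

Lemma center_mul_eq0 z x :
  center R z -> ~ center R x -> center R (z ** x) -> z = 0.
Proof.
by move=> zZ xNZ zxZ; apply: contrapT => /(center_mul_center zZ)/(_ zxZ).
Qed.

(** Since [x, rs] = [x, r]s + r[x, s], the hypothesis gives [x, r]sb = 0 for all s; primeness
    applies once [x, r] is nonzero. *)
Lemma comm_mulIr x b :
  ~ center R x -> (forall r, (x ** r - r ** x) ** b = 0) -> b = 0.
Proof.
move=> /existsNP[r /eqP]; rewrite -subr_eq0 => /eqP xr_neq0 xb.
apply: (prime_mulIr xr_neq0) => s.
by rng from (eqB (xb (r ** s)) (eqMl r (xb s))).
Qed.

Lemma comm_mulIl x b :
  ~ center R x -> (forall r, b ** (x ** r - r ** x) = 0) -> b = 0.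
Proof.
move=> /existsNP[r /eqP]; rewrite -subr_eq0 => /eqP xr_neq0 xb.
apply: (prime_mulIl xr_neq0) => s.
by rng from (eqB (xb (s ** r)) (eqMr r (xb s))).
Qed.

Lemma ideal_annl I a : left_ideal I -> (exists x, I x /\ x <> 0) ->
  (forall u, I u -> a ** u = 0) -> a = 0.
Proof.
case=> _ _ I_mul [x [Ix x_neq0]] aI; apply: (prime_mulIl x_neq0) => r.
by rewrite -rmulA aI //; apply: I_mul.
Qed.

Lemma ideal_annr I b : left_ideal I -> (exists x, I x /\ x <> 0) ->
  (forall u v, I u -> I v -> u ** v ** b = 0) -> forall v, I v -> v ** b = 0.
Proof.
case=> _ _ I_mul [x [Ix x_neq0]] IIb v Iv; apply: (prime_mulIr x_neq0) => r.
by rewrite -(IIb _ _ Ix (I_mul r v Iv)) !rmulA.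
Qed.

(** As x and sx are both central, (rs - sr)x = 0, so commutators annihilate [I]. *)
Lemma comm_left_ideal I : left_ideal I -> (exists x, I x /\ x <> 0) ->
  (forall x, I x -> center R x) -> commutative (@rmul R).
Proof.
move=> idealI I_neq0 IZ r s; have [_ _ I_mul] := idealI.
apply/subr0_eq/(ideal_annl idealI I_neq0) => x Ix.
by have sxZ := IZ _ (I_mul s x Ix); have xZ := IZ _ Ix; rng from (esym (sxZ r)).
Qed.

Lemma comm_ideal_center I x : left_ideal I -> (exists x, I x /\ x <> 0) ->
  (forall y, I y -> x ** y = y ** x) -> center R x.
Proof.
move=> idealI I_neq0 xI r; have [_ _ I_mul] := idealI.
apply/subr0_eq/(ideal_annl idealI I_neq0) => y Iy.
by rng from (eqB (xI _ (I_mul r y Iy)) (eqMl r (xI _ Iy))).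
Qed.

Lemma noncentral_in_ideal I : left_ideal I -> (exists x, I x /\ x <> 0) ->
  ~ commutative (@rmul R) -> exists2 x, I x & ~ center R x.
Proof.
move=> idealI I_neq0; apply: contra_notP => /forall2NP IZ.
by apply: (comm_left_ideal idealI I_neq0) => x Ix; have [//|/contrapT] := IZ x.
Qed.

(** If x is outside [A] and y outside [B], then x - y is in neither: a group is not the union of two
    proper subgroups. *)
Lemma subgroup_union I (A B : set R) :
  (forall x y, I x -> I y -> I (x - y)) ->
  (forall x y, A x -> A y -> A (x - y)) ->
  (forall x y, B x -> B y -> B (x - y)) ->
  (forall x, I x -> A x \/ B x) ->
  (forall x, I x -> A x) \/ (forall x, I x -> B x).
Proof.
move=> IB AB BB IAB; apply: contrapT => /not_orP[].
move=> /existsNP[x /not_implyP[Ix nAx]] /existsNP[y /not_implyP[Iy nBy]].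
have [//|Bx] := IAB _ Ix; have [Ay|//] := IAB _ Iy.
have [Axy|Bxy] := IAB _ (IB _ _ Ix Iy).
- apply: nAx; have -> : x = (x - y) - ((y - y) - y) by rng.
  by apply: (AB) => //; apply: (AB) => //; apply: AB.
- apply: nBy; have -> : y = x - (x - y) by rng.
  exact: BB.
Qed.

(* Posner's theorem, for commuting derivations. *)
Lemma commuting_derivation (d : {additive R -> R}) :
  derivation d -> (forall x, d x ** x = x ** d x) ->
  commutative (@rmul R) \/ forall x, d x = 0.
Proof.
move=> dM dC.
have lin x y : d x ** y + d y ** x = x ** d y + y ** d x.
  have e := dC (x + y); rewrite raddfD in e.
  by rng from (eqB e
    (eqD (dC x) (dC y))).
(* Compares [lin x (y ** x)] with [lin x y] multiplied by x on the right. *)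
have com x y : (x ** y - y ** x) ** d x = 0.
  have e := lin x (y ** x); rewrite dM in e.
  by rng from (eqB (eqD
     (eqMr x (lin x y)) (eqD (eqMl y (dC x)) (eqMl y (dC x)))) e).
have [] := @subgroup_union setT (center R) (fun x => d x = 0).
- by [].
- exact: centerB.
- by move=> x y dx dy; rewrite raddfB dx dy subr0.
- move=> x _; have [|xNZ] := EM (center R x); first by left.
  by right; apply: (comm_mulIr xNZ) => y; apply: com.
- by move=> RZ; left=> x y; rewrite RZ.
- by move=> d0; right=> x; apply: d0.
Qed.

End PrimeRing.

(** * The identity on all of R, with a central constant [c] of both derivations *)

Section WholeRing.
Variables (R : rngType) (F H f h : {additive R -> R}) (c : R).
Hypotheses (primeR : prime_rng R) (ncR : ~ commutative (@rmul R)).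
Hypotheses (genF : generalized_derivation F f).
Hypotheses (genH : generalized_derivation H h).
Hypothesis PZ : forall x y, center R (F x ** F y - H (y ** x)).
Hypotheses (cZ : center R c) (c_neq0 : c <> 0) (fc0 : f c = 0) (hc0 : h c = 0).
Hypothesis f_neq0 : exists x, f x <> 0.
Implicit Types x y : R.

Let fM x y : f (x ** y) = f x ** y + x ** f y := genF.1 x y.
Let hM x y : h (x ** y) = h x ** y + x ** h y := genH.1 x y.
Let FM x y : F (x ** y) = F x ** y + x ** f y := genF.2 x y.
Let HM x y : H (x ** y) = H x ** y + x ** h y := genH.2 x y.

Let Fc x : F x ** c = F c ** x + c ** f x.
Proof. by rewrite -FM cZ FM fc0 rmul0r addr0. Qed.

Let Hc x : H x ** c = H c ** x + c ** h x.
Proof. by rewrite -HM cZ HM hc0 rmul0r addr0. Qed.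

(** This is [P c x], simplified by [h c = 0]. *)
Let p x := F c ** F x - H x ** c.
Let k := F c ** F c - H c ** c.

Let pZ x : center R (p x).
Proof. by have := PZ c x; rewrite HM hc0 rmul0r addr0. Qed.

Let kZ : center R k := pZ c.

Let hE x : c ** c ** h x = k ** x + c ** F c ** f x - c ** p x.
Proof.
rewrite /k /p.
by rng from (eqD (esym (eqMl c (Hc x))) (eqMl (F c) (Fc x))).
Qed.

(** Expands h(xy) = h(x)y + xh(y) by means of [hE]. *)
Let comm_a x y : c ** (F c ** x - x ** F c) ** f y =
  k ** x ** y - c ** p x ** y - c ** p y ** x + c ** p (x ** y).
Proof.
have e := hE (x ** y); rewrite hM fM in e.
have pxZ := pZ x; have pyZ := pZ y; have kZ' := kZ.
by rng from (eqB (eqD (eqMr y (hE x)) (eqMl x (hE y))) e).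
Qed.

Let aZ : center R (F c).
Proof.
apply: contrapT => aNZ; have kZ' := kZ; have paZ := pZ (F c).
(* At [x = F c] the left side of [comm_a] vanishes; taking the commutator of the rest with [F c]
   removes the terms in [p y] and [p (F c ** y)]. *)
have ma : k ** F c - c ** p (F c) = 0.
  apply: (comm_mulIl primeR aNZ) => y.
  have payZ := pZ (F c ** y); have pyZ := pZ y.
  have e := comm_a (F c) y.
  by rng from (eqB (eqMr (F c) e) (eqMl (F c) e)).
have k0 : k = 0.
  apply: (center_mul_eq0 primeR kZ aNZ).
  rewrite -[k ** F c](subrK (c ** p (F c))) ma add0r.
  exact: centerM cZ paZ.
have pa0 : p (F c) = 0.
  apply: (center_mulI primeR cZ c_neq0).
  by move: ma; rewrite k0 rmul0l sub0r => /eqP; rewrite oppr_eq0 => /eqP.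
have p0 y : p y = 0.
  apply: (center_mul_eq0 primeR (pZ y) aNZ).
  have -> : p y ** F c = p (F c ** y); last exact: pZ.
  apply/subr0_eq/(center_mulI primeR cZ c_neq0); have pyZ := pZ y.
  have e := comm_a (F c) y; rewrite k0 pa0 in e.
  by rng from e.
have [x fx_neq0] := f_neq0; apply: fx_neq0.
apply: (comm_mulIr primeR aNZ) => y; apply: (center_mulI primeR cZ c_neq0).
have e := comm_a y x; rewrite k0 !p0 in e.
by rng from e.
Qed.

Let comm_a0 x y :
  k ** x ** y - c ** p x ** y - c ** p y ** x + c ** p (x ** y) = 0.
Proof. by have aZ' := aZ; rewrite -comm_a; rng. Qed.

(** The commutator of [comm_a0 x y] with y leaves [y, x](ky - c p(y)) = 0. *)
Let ky_eq_cpy y : ~ center R y -> k ** y - c ** p y = 0.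
Proof.
move=> yNZ; apply: (comm_mulIr primeR yNZ) => x; have e := comm_a0 x y.
have kZ' := kZ; have pxZ := pZ x; have pyZ := pZ y; have pxyZ := pZ (x ** y).
by rng from (eqB (eqMl y e) (eqMr y e)).
Qed.

Let noncentral : exists y, ~ center R y.
Proof. by apply/existsNP; apply: contra_not ncR => RZ x y; apply: RZ. Qed.

Let k0 : k = 0.
Proof.
have [y yNZ] := noncentral; apply: (center_mul_eq0 primeR kZ yNZ).
rewrite -[k ** y](subrK (c ** p y)) (ky_eq_cpy yNZ) add0r.
exact: centerM cZ (pZ y).
Qed.

Let p0 x : p x = 0.
Proof.
have [y yNZ] := noncentral.
have py0 : p y = 0.
  apply: (center_mulI primeR cZ c_neq0).
  by have e := ky_eq_cpy yNZ; rewrite k0 in e; rng from (eqN e).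
apply: (center_mul_eq0 primeR (pZ x) yNZ).
have -> : p x ** y = p (x ** y); last exact: pZ.
apply/subr0_eq/(center_mulI primeR cZ c_neq0); have pxZ := pZ x.
by have e := comm_a0 x y; rewrite k0 py0 in e; rng from (eqN e).
Qed.

Let chE x : c ** h x = F c ** f x.
Proof.
apply/subr0_eq/(center_mulI primeR cZ c_neq0).
by have e := hE x; rewrite k0 p0 in e; rng from e.
Qed.

Let cHE x : c ** H x = F c ** F x.
Proof. by rewrite cZ; apply/esym/subr0_eq/p0. Qed.

Let fxx_center x : center R (f x ** f x).
Proof.
suff <- : F x ** F x - H (x ** x) = f x ** f x by apply: PZ.
apply/subr0_eq/(center_mulI primeR cZ c_neq0)/(center_mulI primeR cZ c_neq0).
have e := cHE (x ** x); rewrite FM in e; have aZ' := aZ.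
by rng from (eqB (eqB (eqD (eqMr (F x ** c) (Fc x))
  (eqMl (F c ** x + c ** f x) (Fc x))) (eqMl c e))
  (eqMl (F c) (eqMr x (Fc x)))).
Qed.

Let P x y := F x ** F y - H (y ** x).

Let T x y := P x (y ** x) - P x y ** x.

Let TE x y :
  T x y = (F x ** y - y ** F x) ** f x + y ** f x ** f x.
Proof.
apply/esym/subr0_eq/(center_mulI primeR cZ c_neq0); have aZ' := aZ.
rewrite /T /P !FM !HM.
by rng from (eqB (eqMl (y ** x) (chE x)) (eqMl y (eqMr (f x) (Fc x)))).
Qed.

Let T_comm x y : T x y ** x = x ** T x y.
Proof.
rewrite /T; have pZ1 : center R (P x (y ** x)) := PZ _ _.
by have pZ2 : center R (P x y) := PZ _ _; rng.
Qed.

Let comm_T x y : (F x ** x - x ** F x) ** T x y = 0.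
Proof.
have TFy : T x (F x ** y) = F x ** T x y by rewrite !TE; rng.
have e := T_comm x (F x ** y); rewrite TFy in e.
by rng from (eqD (eqMl (F x) (esym (T_comm x y))) e).
Qed.

Let comm_F x : c ** (F x ** x - x ** F x) = c ** (f x ** x - x ** f x).
Proof. by have aZ' := aZ; rng from (eqB (eqMr x (Fc x)) (eqMl x (Fc x))). Qed.

Let fxx0 x : f x ** x <> x ** f x -> f x ** f x = 0.
Proof.
move=> kN0; apply: contrapT => fxx_neq0; apply/kN0/subr0_eq.
apply: (center_mulI primeR cZ c_neq0); rewrite -comm_F.
(* At [y = c] the commutator in [TE] vanishes, and only c times the square of [f x] remains. *)
have e := comm_T x c; rewrite TE -rmulA in e; have wZ := fxx_center x.
apply: (center_mulI primeR wZ fxx_neq0).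
(* [rng] splits products, so the central square must become a variable to count as a central
   atom. *)
by move: (f x ** f x) wZ e => w wZ e; rng from e.
Qed.

(** Let w = [f x] and n = [T x y]. If [w, x] is nonzero, then ww = 0 and nw = 0, whence wn =
    -[P x y][w, x]. Primeness gives wn = 0 from wntwn = 0, a contradiction when [P x y] is
    nonzero. *)
Let f_commuting x : f x ** x = x ** f x.
Proof.
apply: contrapT => kN0; have ww0 := fxx0 kN0.
have w_neq0 : f x <> 0 by move=> w0; apply: kN0; rewrite w0 rmul0l rmul0r.
have TE0 y : T x y = (F x ** y - y ** F x) ** f x.
  by rewrite TE -rmulA ww0 rmul0r addr0.
have Tw0 y : T x y ** f x = 0 by rewrite TE0 -rmulA ww0 rmul0r.
have kT0 y : (f x ** x - x ** f x) ** T x y = 0.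
  apply: (center_mulI primeR cZ c_neq0).
  by rewrite rmulA -comm_F -rmulA comm_T rmul0r.
(* If [P x] were zero, each [T x z] would be central and kill w, hence vanish; then [[F x], z]w = 0
   would make [F x] central. *)
have [y r_neq0] : exists y, P x y <> 0.
  apply/existsNP => Px0; apply/kN0/subr0_eq/(center_mulI primeR cZ c_neq0).
  rewrite -comm_F; suff FZ : center R (F x) by rewrite FZ subrr rmul0r.
  apply: contrapT => FNZ; apply/w_neq0/(comm_mulIr primeR FNZ) => z.
  have TZ : center R (T x z) by rewrite /T (Px0 z) rmul0l subr0; apply: PZ.
  rewrite -TE0.
  by apply: contrapT => T_neq0; apply/w_neq0/(center_mulI primeR TZ T_neq0)/Tw0.
have rZ : center R (P x y) := PZ _ _.
have qZ : center R (P x (y ** x)) := PZ _ _.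
have wn : f x ** T x y = - (P x y ** (f x ** x - x ** f x)).
  by have nw := Tw0 y; rewrite /T in nw *; rng from nw.
have wnn0 : f x ** T x y ** T x y = 0.
  by rewrite wn rmulNl -rmulA kT0 rmul0r oppr0.
suff wn0 : f x ** T x y = 0.
  apply/kN0/subr0_eq/(center_mulI primeR rZ r_neq0).
  by apply: oppr_inj; rewrite -wn wn0 oppr0.
(* With n = T x y, [ntw] and [rntw] make n ** t ** f x a multiple of n, while
   f x ** n ** n = 0. *)
suff wntwn0 t : f x ** T x y ** t ** (f x ** T x y) = 0.
  by case: (primeR wntwn0).
apply: (center_mulI primeR rZ r_neq0).
(* Up to central factors, w is an eigenvector of left multiplication by [F x]. *)
have rFw : P x y ** c ** F x ** f x = F c ** P x (y ** x) ** f x.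
  have nw := Tw0 y; rewrite /T in nw; have aZ' := aZ.
  rng from (eqB (eqD (eqMl (P x y) (eqMr (f x) (Fc x))) (eqMl (P x y ** c) ww0))
    (eqMl (F c) nw)).
have ntw : T x (y ** f x ** t) = T x y ** t ** f x.
  apply/subr0_eq/(center_mulI primeR cZ c_neq0)/(center_mulI primeR rZ r_neq0).
  have aZ' := aZ; rewrite !TE0.
  rng from (eqB (eqMl y (eqMr (t ** f x) rFw)) (eqMl (y ** f x ** t) rFw)).
have r'Z : center R (P x (y ** f x ** t)) := PZ _ _.
have q'Z : center R (P x (y ** f x ** t ** x)) := PZ _ _.
(* In [z] the multiples of x cancel, so [z] is central; it kills w, hence is zero. *)
have rntw : P x y ** (T x y ** t ** f x) = P x (y ** f x ** t) ** T x y.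
  rewrite -ntw; apply: subr0_eq; set z := _ - _.
  have zZ : center R z.
    suff -> : z = P x y ** P x (y ** f x ** t ** x)
                - P x (y ** f x ** t) ** P x (y ** x).
      by apply: centerB; apply: centerM.
    by rewrite /z /T; rng.
  apply: contrapT => z_neq0; apply/w_neq0/(center_mulI primeR zZ z_neq0).
  by rewrite /z; rng from (eqB (eqMl (P x y) (Tw0 (y ** f x ** t)))
    (eqMl (P x (y ** f x ** t)) (Tw0 y))).
by rng from (eqD (eqMl (f x) (eqMr (T x y) rntw))
  (eqMl (P x (y ** f x ** t)) wnn0)).
Qed.

Lemma whole_ring_contradiction : False.
Proof.
have [|f0] := commuting_derivation primeR genF.1 f_commuting; first exact: ncR.
by have [x] := f_neq0; apply; apply: f0.
Qed.

End WholeRing.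

(** * From the left ideal to the whole ring *)

Section LeftIdeal.
Variables (R : rngType) (I : set R) (F H f h : {additive R -> R}).
Hypotheses (primeR : prime_rng R) (idealI : left_ideal I).
Hypothesis I_neq0 : exists x, I x /\ x <> 0.
Hypotheses (genF : generalized_derivation F f).
Hypotheses (genH : generalized_derivation H h).
Hypothesis FH_center : forall x y, I x -> I y ->
  center R (F x ** F y - H (y ** x)).
Hypotheses (f_stable : nonzero_stable f I) (h_stable : nonzero_stable h I).
Implicit Types (r x y u v : R).

Let IB x y : I x -> I y -> I (x - y).
Proof. by case: idealI => _ IB _; apply: IB. Qed.

Let ID x y : I x -> I y -> I (x + y).
Proof.
case: idealI => I0 _ _ Ix Iy; have -> : x + y = x - (0 - y) by rng.
exact/IB/IB.
Qed.

Let IM r x : I x -> I (r ** x).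
Proof. by case: idealI => _ _; apply. Qed.

Let fI u v : I u -> I v -> I (u ** f v).
Proof. by case: f_stable => + _; apply. Qed.

Let hI u v : I u -> I v -> I (u ** h v).
Proof. by case: h_stable => + _; apply. Qed.

Let fM x y : f (x ** y) = f x ** y + x ** f y := genF.1 x y.
Let hM x y : h (x ** y) = h x ** y + x ** h y := genH.1 x y.
Let FM x y : F (x ** y) = F x ** y + x ** f y := genF.2 x y.
Let HM x y : H (x ** y) = H x ** y + x ** h y := genH.2 x y.

Let FI u v : I u -> I v -> I (F (u ** v)).
Proof. by move=> Iu Iv; rewrite FM; apply: ID; [apply: IM | apply: fI]. Qed.

Lemma ideal_center_neq0 : exists c, [/\ I c, center R c & c <> 0].
Proof.
apply: contrapT => /forallNP IZ0.
have Z0 z : I z -> center R z -> z = 0.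
  by move=> Iz zZ; apply: contrapT => z_neq0; apply: (IZ0 z).
have P0 x u v : I x -> I u -> I v -> F x ** F (u ** v) = H (u ** v ** x).
  move=> Ix Iu Iv; apply/subr0_eq/Z0; last by apply: FH_center => //; apply: IM.
  (* Membership in [I] rests on stability: under [f] for [F (u ** v)], under [h] for
     [u ** v ** h x]. *)
  apply: IB; first by apply/IM/FI.
  rewrite HM; apply: ID; first exact: IM.
  by rewrite -rmulA; apply/IM/hI.
have diag x u v : I x -> I u -> I v ->
    F x ** u ** v ** f x = u ** v ** x ** h x.
  move=> Ix Iu Iv; have e := P0 x u (v ** x) Ix Iu (IM _ Ix).
  rewrite rmulA FM HM in e.
  by rng from (eqB e (eqMr x (P0 x u v Ix Iu Iv))).
have [] := @subgroup_union _ I [set x | center R (F x)]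
    [set x | forall v, I v -> v ** f x = 0].
- exact: IB.
- by move=> x y /= Fx Fy; rewrite raddfB; apply: centerB.
- by move=> x y /= fx fy v Iv; rewrite raddfB rmulDr rmulNr fx // fy // subrr.
- move=> x Ix; have [|FNZ] := EM (center R (F x)); [by left | right].
  apply: (ideal_annr primeR idealI I_neq0) => u v Iu Iv.
  apply: (comm_mulIr primeR FNZ) => r.
  by rng from (eqB (diag x (r ** u) v Ix (IM r Iu) Iv)
    (eqMl r (diag x u v Ix Iu Iv))).
- move=> /= FZ; have F0 u v : I u -> I v -> F (u ** v) = 0.
    by move=> Iu Iv; apply: Z0; [apply: FI | apply: FZ; apply: IM].
  have H0 x u v : I x -> I u -> I v -> H (u ** v ** x) = 0.
    by move=> Ix Iu Iv; rewrite -P0 // F0 // rmul0r.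
  have [_ [u [v [Iu Iv]]]] := h_stable; apply.
  (* Two uses of [ideal_annr] reduce the claim to products of three elements of [I] with [h v],
     where [H0] applies. *)
  move: u Iu; apply: (ideal_annr primeR idealI I_neq0) => u w Iu Iw.
  rewrite -rmulA.
  move: u Iu; apply: (ideal_annr primeR idealI I_neq0) => u x Iu Ix.
  have e := HM (u ** x ** w) v.
  rewrite !H0 // in e; last exact: IM.
  by rng from (esym e).
- move=> /= If0; have [_ [u [v [Iu Iv]]]] := f_stable.
  by case; apply: If0.
Qed.

(** * Left ideals containing a nonzero central element *)

Section Center.
Variable c : R.
Hypotheses (Ic : I c) (cZ : center R c) (c_neq0 : c <> 0).
Hypothesis ncR : ~ commutative (@rmul R).

Let fcZ : center R (f c) := center_derivation genF.1 cZ.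
Let hcZ : center R (h c) := center_derivation genH.1 cZ.

(** This is [P x (y ** c) - P x y ** c]. *)
Let fh_center x y : I x -> I y ->
  center R (f c ** F x ** y - h c ** y ** x).
Proof.
move=> Ix Iy; have Icy : I (y ** c) by apply: IM.
have P1 := FH_center Ix Icy; have P2 := FH_center Ix Iy.
suff -> : f c ** F x ** y - h c ** y ** x =
  (F x ** F (y ** c) - H (y ** c ** x)) - (F x ** F y - H (y ** x)) ** c.
  by apply: centerB => //; apply: centerM.
rewrite -[y ** c ** x]rmulA cZ rmulA FM HM.
by have := fcZ; have := hcZ; rng.
Qed.

(** By [fh_center] at [y = c] the element is central, and at [y = x] so is its product with x: it
    vanishes for noncentral x. A central x is a difference of two noncentral elements of [I]. *)
Let fh0 x : I x -> f c ** F x - h c ** x = 0.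
Proof.
have fhZ z : I z -> center R (f c ** F z - h c ** z).
  move=> Iz; apply: (center_mul_center primeR cZ c_neq0).
  suff -> : c ** (f c ** F z - h c ** z) = f c ** F z ** c - h c ** c ** z.
    exact: fh_center.
  by rng.
have fhM z : I z -> ~ center R z -> f c ** F z - h c ** z = 0.
  move=> Iz zNZ; apply: (center_mul_eq0 primeR (fhZ _ Iz) zNZ).
  by rewrite rmulDl rmulNl; apply: fh_center.
move=> Ix; have [xZ|] := EM (center R x); last exact: fhM.
have [y Iy yNZ] := noncentral_in_ideal primeR idealI I_neq0 ncR.
have := fhM (x + y) (ID Ix Iy); rewrite raddfD => e.
have xyNZ : ~ center R (x + y).
  by move=> /centerB/(_ xZ); rewrite addrAC subrr add0r.
by rng from (eqB (e xyNZ) (fhM _ Iy yNZ)).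
Qed.

(** By [fh0], [fh_center] makes h(c)[x, y] central. Replacing y by xy multiplies it by the
    noncentral x, so it is zero; a nonzero h(c) would then make x central. *)
Let hc0 : h c = 0.
Proof.
have [x Ix xNZ] := noncentral_in_ideal primeR idealI I_neq0 ncR.
have hxyZ y : I y -> center R (h c ** (x ** y - y ** x)).
  move=> Iy; suff -> : h c ** (x ** y - y ** x) =
    f c ** F x ** y - h c ** y ** x.
    exact: fh_center.
  by have hcZ' := hcZ; have e := fh0 Ix; rng from (eqN (eqMr y e)).
apply: contrapT => hc_neq0.
apply/xNZ/(comm_ideal_center primeR idealI I_neq0) => y Iy.
apply/subr0_eq/(center_mulI primeR hcZ hc_neq0).
apply: (center_mul_eq0 primeR (hxyZ _ Iy) xNZ).
suff -> : h c ** (x ** y - y ** x) ** x =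
  h c ** (x ** (x ** y) - x ** y ** x) by apply/hxyZ/IM.
by rewrite (hxyZ _ Iy); have hcZ' := hcZ; rng.
Qed.

Let fc0 : f c = 0.
Proof.
apply: contrapT => fc_neq0; have [_ [x [y [Ix Iy]]]] := f_stable; apply.
have F0 z : I z -> F z = 0.
  move=> Iz; apply: (center_mulI primeR fcZ fc_neq0).
  by have e := fh0 Iz; rewrite hc0 rmul0l subr0 in e.
by have e := FM x y; rewrite !F0 // in e; [rng from (esym e) | apply: IM].
Qed.

(** As cx and cy lie in [I], the hypothesis applies to them, and [f c = h c = 0] turns it into
    cc[P x y]. *)
Let PZ x y : center R (F x ** F y - H (y ** x)).
Proof.
have Icr r : I (c ** r) by rewrite cZ; apply: IM.
apply/(center_mul_center primeR cZ c_neq0)/(center_mul_center primeR cZ c_neq0).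
suff -> : c ** (c ** (F x ** F y - H (y ** x))) =
  F (c ** x) ** F (c ** y) - H (c ** y ** (c ** x)) by apply: FH_center.
have -> : c ** y ** (c ** x) = y ** x ** c ** c by rng.
by rewrite [c ** x]cZ [c ** y]cZ !FM !(HM _ c) fc0 hc0; rng.
Qed.

Lemma left_ideal_contradiction : False.
Proof.
apply: (whole_ring_contradiction primeR ncR genF genH PZ cZ c_neq0 fc0 hc0).
have [_ [x [y [_ _ xfy_neq0]]]] := f_stable; exists y => fy0.
by apply: xfy_neq0; rewrite fy0 rmul0r.
Qed.

End Center.
End LeftIdeal.

Theorem theorem3p6 (R : rngType) (I : set R) (F H f h : {additive R -> R})
  (primeR : prime_rng R)
  (idealI : left_ideal I)
  (I_neq0 : exists x : R, I x /\ x <> 0)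
  (genF : generalized_derivation F f)
  (genH : generalized_derivation H h)
  (FH_center : forall x y : R, I x -> I y ->
     center R (F x ** F y - H (y ** x)))
  (f_stable : nonzero_stable f I)
  (h_stable : nonzero_stable h I) :
  commutative (@rmul R).
Proof.
have [c [Ic cZ c_neq0]] := ideal_center_neq0 primeR idealI I_neq0 genF genH
  FH_center f_stable h_stable.
apply: contrapT => ncR.
exact: (left_ideal_contradiction primeR idealI I_neq0 genF genH FH_center
  f_stable Ic cZ c_neq0 ncR).
Qed.
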